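(* Let $\mathcal{M}$ be a compact topological space, let $k \in \mathbb{N}$, and let $f = (f_0, f_1, \dots, f_k) : \mathcal{M} \to \mathbb{R}^{k+1}$ be a continuous function that is Lagrangian dual sectioned. Then for any $c \in \mathbb{R}^k$, $$V_f(c) = \max\{ y_0 : y_1 = c_1, \dots, y_k = c_k,\ y = (y_0, \dots, y_k) \in \operatorname{conv}(f(\mathcal{M}))\}.$$
   Context: Optimal value function: for $c \in \mathbb{R}^k$, $V_f(c) = \max\{ f_0(x) : f_1(x) = c_1, \dots, f_k(x) = c_k,\ x \in \mathcal{M}\}$. A maximum over an empty set is assigned the value $-\infty$. Let $\mathbb{R}^{k+1}_{0+} := \{ t \in \mathbb{R}^{k+1} : t_0 \ge 0,\ t \neq 0\}$ (coordinates indexed $0,\dots,k$). A Lagrangian dual section of $f$ is a continuous function $D : \mathbb{R}^{k+1}_{0+} \to \mathcal{M}$ such that for every $t \in \mathbb{R}^{k+1}_{0+}$, $D(t)$ is a maximizer over $x \in \mathcal{M}$ of $\langle t, f(x) \rangle$. The function $f$ is Lagrangian dual sectioned if such a $D$ exists. *)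

(* Defs.v *)
From HB Require Import structures.
From mathcomp Require Import all_boot all_order all_algebra.
From mathcomp Require Import all_classical all_reals all_analysis.

Set Implicit Arguments.
Unset Strict Implicit.
Unset Printing Implicit Defensive.

Import Order.TTheory GRing.Theory Num.Theory.
Import numFieldNormedType.Exports.

Local Open Scope classical_set_scope.
Local Open Scope ring_scope.

Definition has_max (R : realType) (A : set R) : Prop :=
  A `&` ubound A !=set0.

(* A nonempty set without maximum also gets the default value -oo; statements
   about emax A must therefore assert has_max A for nonempty A. *)
Definition emax (R : realType) (A : set R) : \bar R :=
  xget -oo%E [set a%:E | a in A `&` ubound A].

Definition conv_hull (R : realType) (n : nat) (A : set 'rV[R]_n) :
    set 'rV[R]_n :=
  smallest (@convex_set R 'rV[R]_n) A.

Definition inner (R : realType) (n : nat) (t y : 'rV[R]_n) : R :=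
  \sum_(i < n) t ord0 i * y ord0 i.

(* A vector of R^(k+1) is indexed by 'I_k.+1: ord0 is the coordinate 0, and
   lift ord0 i, for i : 'I_k, is the coordinate i + 1. *)
Definition on_fiber (R : realType) (k : nat) (c : 'rV[R]_k)
    (y : 'rV[R]_k.+1) : Prop :=
  forall i : 'I_k, y ord0 (lift ord0 i) = c ord0 i.

Definition fiber_values (R : realType) (k : nat) (Y : set 'rV[R]_k.+1)
    (c : 'rV[R]_k) : set R :=
  [set y ord0 ord0 | y in Y `&` on_fiber c].

Definition feasible_values (R : realType) (M : topologicalType) (k : nat)
    (f : M -> 'rV[R]_k.+1) (c : 'rV[R]_k) : set R :=
  [set f x ord0 ord0 | x in [set x | on_fiber c (f x)]].

Definition optimal_value (R : realType) (M : topologicalType) (k : nat)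
    (f : M -> 'rV[R]_k.+1) (c : 'rV[R]_k) : \bar R :=
  emax (feasible_values f c).

Definition dual_domain (R : realType) (k : nat) : set 'rV[R]_k.+1 :=
  [set t | 0 <= t ord0 ord0 /\ t != 0].

(* D is totalized: only its restriction to dual_domain is constrained, with
   continuity taken for the subspace topology. *)
Definition Lagrangian_dual_section (R : realType) (M : topologicalType)
    (k : nat) (f : M -> 'rV[R]_k.+1) (D : 'rV[R]_k.+1 -> M) : Prop :=
  {within @dual_domain R k, continuous D} /\
  forall t, @dual_domain R k t ->
    forall x, inner t (f x) <= inner t (f (D t)).

Definition Lagrangian_dual_sectioned (R : realType) (M : topologicalType)
    (k : nat) (f : M -> 'rV[R]_k.+1) : Prop :=
  exists D : 'rV[R]_k.+1 -> M, Lagrangian_dual_section f D.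

(* Main.v *)
(* Let y be in the convex hull of f(M) and sigma(t) = max <t, f - y>, which is
   nonnegative.  Fix t_0 = 1.  The continuous section D is a continuous choice
   of subgradients f(D(t)) - y of the convex function sigma, so sigma is
   differentiable.  The penalized function sigma(t) + (e/2) |t|^2 is coercive;
   at its minimum, the coordinates i >= 1 of f(D(t)) - y equal - e t_i, which
   tends to 0 with e because e |t|^2 stays bounded, and then
   sigma(t) = (f(D(t)) - y)_0 - e (t_1^2 + ... + t_k^2) >= 0 makes the coordinate
   0 nonnegative.  Compactness of M turns these approximate solutions into a
   point x with f_i(x) = y_i for i >= 1 and f_0(x) >= y_0. *)

Require Import Defs.
From HB Require Import structures.
From mathcomp Require Import all_boot all_order all_algebra.
From mathcomp Require Import all_classical all_reals all_analysis.
From mathcomp Require Import ring lra.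
Set Implicit Arguments.
Unset Strict Implicit.
Unset Printing Implicit Defensive.

Import Order.TTheory GRing.Theory Num.Theory.
Import numFieldNormedType.Exports.
Local Open Scope classical_set_scope.
Local Open Scope ring_scope.

(** * Inner product of row vectors and half-spaces *)

Lemma innerDl (R : realType) (n : nat) (t u y : 'rV[R]_n) :
  inner (t + u) y = inner t y + inner u y.
Proof.
by rewrite -big_split; apply: eq_bigr => i _; rewrite mxE mulrDl.
Qed.

Lemma innerZl (R : realType) (n : nat) (a : R) (t y : 'rV[R]_n) :
  inner (a *: t) y = a * inner t y.
Proof. by rewrite mulr_sumr; apply: eq_bigr => i _; rewrite mxE mulrA. Qed.

Lemma innerC (R : realType) (n : nat) (t y : 'rV[R]_n) : inner t y = inner y t.
Proof. by apply: eq_bigr => i _; rewrite mulrC. Qed.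

Lemma innerDr (R : realType) (n : nat) (t y z : 'rV[R]_n) :
  inner t (y + z) = inner t y + inner t z.
Proof. by rewrite innerC innerDl !(innerC t). Qed.

Lemma innerZr (R : realType) (n : nat) (a : R) (t y : 'rV[R]_n) :
  inner t (a *: y) = a * inner t y.
Proof. by rewrite innerC innerZl innerC. Qed.

Lemma inner_delta (R : realType) (n : nat) (i : 'I_n) (y : 'rV[R]_n) :
  inner (delta_mx ord0 i) y = y ord0 i.
Proof.
rewrite /inner (bigD1 i) //= mxE !eqxx mul1r big1 ?addr0 // => j ji.
by rewrite mxE (negbTE ji) andbF mul0r.
Qed.

Lemma sqr_le_inner (R : realType) (n : nat) (i : 'I_n) (t : 'rV[R]_n) :
  t ord0 i ^+ 2 <= inner t t.
Proof.
rewrite /inner (bigD1 i) //= -expr2 lerDl sumr_ge0 // => j _.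
by rewrite -expr2 sqr_ge0.
Qed.

Lemma cvg_inner (R : realType) (n : nat) (T : Type) (F : set_system T)
    (FF : Filter F) (u v : T -> 'rV[R]_n) (a b : 'rV[R]_n) :
  u @ F --> a -> v @ F --> b -> inner (u x) (v x) @[x --> F] --> inner a b.
Proof.
move=> ua vb; apply: cvg_big => [|i _]; first exact: add_continuous.
apply: cvgM.
  exact: (cvg_comp _ _ ua (@coord_continuous R 1 n ord0 i a)).
exact: (cvg_comp _ _ vb (@coord_continuous R 1 n ord0 i b)).
Qed.

(** A half-space containing [A] is convex, hence contains the smallest convex set over [A]. *)
Lemma conv_hull_inner_le (R : realType) (n : nat) (A : set 'rV[R]_n)
    (t y : 'rV[R]_n) (b : R) :
  (forall z, A z -> inner t z <= b) -> conv_hull A y -> inner t y <= b.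
Proof.
move=> Ab; apply: (@smallest_sub _ _ _ [set z | inner t z <= b]) => //.
move=> z w l /set_mem /= zb /set_mem /= wb; apply/mem_set => /=.
rewrite /conv /= innerDr !innerZr /unstable.onem.
have l0 : 0 <= l%:num by [].
have l1 : l%:num <= 1 by [].
by nra.
Qed.

(** The normalization t_0 = 1 stays inside [dual_domain] and is preserved by steps along any [v]
    with v_0 = 0, so a minimum over it is unconstrained in the coordinates i >= 1. *)
Definition normal_slice (R : realType) (k : nat) : set 'rV[R]_k.+1 :=
  [set t | t ord0 ord0 = 1].

Lemma within_continuous_comp (T U V : topologicalType) (A : set U)
    (h : T -> U) (g : U -> V) :
  {within A, continuous g} -> continuous h -> (forall x, A (h x)) ->
  continuous (g \o h).
Proof.
move=> /subspace_continuousP gA hc Ah x.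
apply: (@cvg_comp _ _ _ h g _ (within A (nbhs (h x)))); last exact: gA.
move=> P /= /hc; rewrite /nbhs /=; apply: filterS => z; exact.
Qed.

(** * Minimizing the penalized support function *)

Section penalized_minimum.
Context (R : realType) (k : nat) (G : 'rV[R]_k.+1 -> 'rV[R]_k.+1).
(** [G t] abstracts f(D(t)) - y: [Gmax] records the optimality of D(t), and [Gge0] that y lies in
    the convex hull. *)
Hypothesis Gcont : {within @normal_slice R k, continuous G}.
Hypothesis Gmax : forall t u, normal_slice t -> normal_slice u ->
  inner t (G u) <= inner t (G t).
Hypothesis Gge0 : forall t, normal_slice t -> 0 <= inner t (G t).

Let F (e : R) t := inner t (G t) + e / 2 * inner t t.

Let e0 : 'rV[R]_k.+1 := delta_mx ord0 ord0.

Lemma penalized_min (e : R) : 0 < e ->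
  exists2 t, normal_slice t & forall u, normal_slice u -> F e t <= F e u.
Proof.
move=> e_gt0.
have Ae0 : normal_slice e0 by rewrite /normal_slice /e0 /= mxE.
(* Since [B >= 1] and [B * e = e + 2 * F e e0], the penalty [e / 2 * B ^+ 2] exceeds [F e e0]. The
   degenerate interval at index 0 keeps the box [K] inside the slice. *)
pose B := 1 + 2 * F e e0 / e.
pose I (j : 'I_k.+1) : set R :=
  if j == ord0 then `[1, 1]%classic else `[- B, B]%classic.
pose K := [set v : 'rV[R]_k.+1 | forall j, I j (v ord0 j)].
have F_ge u : normal_slice u -> e / 2 * inner u u <= F e u.
  by move=> Au; rewrite /F lerDr; exact: Gge0.
have Fe0_ge0 : 0 <= F e e0.
  by have := F_ge _ Ae0; have := sqr_le_inner ord0 e0; nra.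
have B_ge1 : 1 <= B by rewrite lerDl divr_ge0 ?(ltW e_gt0) // mulr_ge0.
have KA : K `<=` @normal_slice R k.
  move=> v /(_ ord0); rewrite /I eqxx /= in_itv /= => v1.
  by apply/eqP; rewrite eq_le andbC.
have Kcpt : compact K.
  by apply: rV_compact => j; rewrite /I; case: ifP => _; exact: segment_compact.
have Ke0 : K e0.
  move=> j; rewrite /I; case: ifPn => [/eqP ->|j0] /=; rewrite in_itv /= mxE.
    by rewrite !eqxx /= lexx.
  by rewrite (negbTE j0) andbF oppr_le0 (le_trans ler01 B_ge1).
have Fcont : {within K, continuous (F e)}.
  apply: (continuous_subspaceW KA); apply/subspace_continuousP => t At.
  have idc : u @[u --> within (@normal_slice R k) (nbhs t)] --> t by exact: cvg_within.
  apply: cvgD; first by apply: cvg_inner => //; move/subspace_continuousP : Gcont; exact.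
  by apply: cvgMr; exact: cvg_inner.
have [t /set_mem Kt tmin] := EVT_min_rV (ex_intro _ _ Ke0) Kcpt Fcont.
exists t; first exact: KA.
(* Outside [K] some coordinate j other than 0 has absolute value above [B]; the penalty alone then
   makes [F e u] larger than [F e e0], and [e0] is in [K]. *)
move=> u Au; have [/mem_set/tmin //|nKu] := pselect (K u).
apply: (le_trans (tmin _ (mem_set Ke0))).
have [j nIj] : exists j, ~ I j (u ord0 j) by exact/existsNP.
have uj : B ^+ 2 < u ord0 j ^+ 2.
  move: nIj; rewrite /I; case: ifPn => [/eqP ->|_] /=; rewrite in_itv /=.
    by rewrite Au lexx.
  move=> /negP; rewrite negb_and -!ltNge => /orP[]; nra.
have BE : B * e = e + 2 * F e e0 by rewrite /B mulrDl mul1r divfK ?gt_eqF.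
have := F_ge _ Au; have := sqr_le_inner j u.
by nra.
Qed.

(* Since [G u] is optimal for [u], the increment of [<., G .>] from [t] to
   [t + s v] is at most [s <v, G (t + s v)>]: continuity of [G] gives the first
   order condition without differentiating the support function. *)
Lemma penalized_min_stationary (e : R) (t v : 'rV[R]_k.+1) :
  normal_slice t ->
  (forall u, normal_slice u -> F e t <= F e u) ->
  v ord0 ord0 = 0 -> 0 <= inner v (G t) + e * inner t v.
Proof.
move=> At tmin v0.
have Au s : normal_slice (t + s *: v).
  by rewrite /normal_slice /= !mxE v0 mulr0 addr0.
(* For s > 0, [s * p s] bounds the whole increment of [F e], penalty included, so [p s >= 0]; the
   claim is the limit [p 0 >= 0]. *)
pose p s := inner v (G (t + s *: v)) + e * inner t v + e / 2 * (s * inner v v).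
have lc : continuous (fun s : R => t + s *: v).
  by move=> s; apply: cvgD; [exact: cvg_cst|exact: scalel_continuous].
have pc : p s @[s --> (0 : R)^'+] --> p 0.
  apply: cvg_at_right_filter.
  apply: cvgD; last by apply: cvgMr; apply: cvgMl; exact: cvg_id.
  apply: cvgD; last exact: cvg_cst.
  apply: cvg_inner; first exact: cvg_cst.
  exact: (within_continuous_comp Gcont lc).
have -> : inner v (G t) + e * inner t v = p 0.
  by rewrite /p scale0r mul0r mulr0 !addr0.
rewrite -(cvg_lim _ pc) //; apply: limr_ge; first by apply/cvg_ex; exists (p 0).
near=> s; have s0 : 0 < s by [].
have := tmin _ (Au s); have := Gmax At (Au s).
rewrite /F !innerDl !innerZl !innerDr !innerZr (innerC v t) => h1 h2.
rewrite -(pmulr_rge0 _ s0) /p; nra.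
Unshelve. all: by end_near.
Qed.

Lemma exists_almost_fiber (d : R) : 0 < d ->
  exists t, [/\ normal_slice t, 0 <= G t ord0 ord0 &
    \sum_(i < k) G t ord0 (lift ord0 i) ^+ 2 <= d].
Proof.
move=> d_gt0.
have Ae0 : normal_slice e0 by rewrite /normal_slice /e0 /= mxE.
have C_ge0 := Gge0 Ae0; set C := inner e0 (G e0) in C_ge0.
(* This choice gives [2 * C * e <= d]. With S the sum of the t_i^2 for i >= 1, comparing the minimum
   with [e0] yields e S <= 2 C, hence e^2 S <= d. *)
pose e := d / (2 * C + 1 + d).
have D_gt0 : 0 < 2 * C + 1 + d by lra.
have e_gt0 : 0 < e by exact: divr_gt0.
have eE : e * (2 * C + 1 + d) = d by rewrite divfK ?gt_eqF.
have [t At tmin] := penalized_min e_gt0.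
(* Stationarity along both [v] and [- v] turns the inequality into an equality. *)
have Gt i : G t ord0 (lift ord0 i) = - e * t ord0 (lift ord0 i).
  pose v : 'rV[R]_k.+1 := delta_mx ord0 (lift ord0 i).
  have v0 : v ord0 ord0 = 0 by rewrite mxE.
  have Nv0 : ((-1) *: v) ord0 ord0 = 0 by rewrite mxE v0 mulr0.
  have := penalized_min_stationary At tmin Nv0.
  have := penalized_min_stationary At tmin v0.
  rewrite innerZl innerZr (innerC t v) !inner_delta; lra.
have tt : inner t t = 1 + \sum_(i < k) t ord0 (lift ord0 i) ^+ 2.
  by rewrite /inner big_ord_recl At mul1r.
have tG : inner t (G t) = G t ord0 ord0 - e * \sum_(i < k) t ord0 (lift ord0 i) ^+ 2.
  rewrite /inner big_ord_recl At mul1r mulr_sumr -sumrN; congr (_ + _).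
  by apply: eq_bigr => i _; rewrite Gt; ring.
have GG : \sum_(i < k) G t ord0 (lift ord0 i) ^+ 2 =
    e ^+ 2 * \sum_(i < k) t ord0 (lift ord0 i) ^+ 2.
  by rewrite mulr_sumr; apply: eq_bigr => i _; rewrite Gt; ring.
have S_ge0 : 0 <= \sum_(i < k) t ord0 (lift ord0 i) ^+ 2.
  by apply: sumr_ge0 => i _; rewrite sqr_ge0.
have tGge0 := Gge0 At.
have := tmin _ Ae0; rewrite /F -/C inner_delta mxE !eqxx /= tt.
exists t; split => //; first by move: tGge0; rewrite tG; nra.
rewrite GG; nra.
Qed.

End penalized_minimum.

(** * From approximate to exact solutions by compactness *)

Lemma continuous_coord (R : realType) (n : nat) (T : topologicalType)
    (f : T -> 'rV[R]_n) (j : 'I_n) :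
  continuous f -> continuous (fun x => f x ord0 j).
Proof.
move=> fc x.
exact: (cvg_comp _ _ (fc x) (@coord_continuous R 1 n ord0 j (f x))).
Qed.

Lemma conv_hull_dominated (R : realType) (M : topologicalType) (k : nat)
    (f : M -> 'rV[R]_k.+1) (cptM : compact [set: M]) (ctsf : continuous f)
    (dsf : Lagrangian_dual_sectioned f) (y : 'rV[R]_k.+1) :
  conv_hull (range f) y ->
  exists2 x, (forall i : 'I_k, f x ord0 (lift ord0 i) = y ord0 (lift ord0 i)) &
    y ord0 ord0 <= f x ord0 ord0.
Proof.
move=> yf; have [D [Dcont Dmax]] := dsf.
pose G t := f (D t) - y.
have sliceS : @normal_slice R k `<=` @dual_domain R k.
  move=> t t1; split; first by rewrite t1.
  apply/eqP => t0; have /eqP : (1 : R) = 0 by rewrite -[LHS]t1 t0.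
  by rewrite oner_eq0.
have Gcont : {within @normal_slice R k, continuous G}.
  apply/subspace_continuousP => t At; apply: cvgB; last exact: cvg_cst.
  apply: (@cvg_comp _ _ _ D f _ (nbhs (D t))); last exact: ctsf.
  by have /subspace_continuousP := continuous_subspaceW sliceS Dcont; exact.
have innerG t u : inner t (G u) = inner t (f (D u)) - inner t y.
  by rewrite /G -scaleN1r innerDr innerZr mulN1r.
have Gmax t u : normal_slice t -> normal_slice u ->
    inner t (G u) <= inner t (G t).
  by move=> /sliceS At _; rewrite !innerG lerD2r; exact: Dmax.
(* The bound by the value at D(t) holds on f(M), hence at the point [y] of its convex hull. *)
have Gge0 t : normal_slice t -> 0 <= inner t (G t).
  move=> /sliceS At; rewrite innerG subr_ge0; apply: conv_hull_inner_le yf.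
  by move=> _ [x _ <-]; exact: Dmax.
have fc j : continuous (fun x => f x ord0 j) by exact: continuous_coord.
pose N := [set x | y ord0 ord0 <= f x ord0 ord0].
have Ncpt : compact N.
  apply: (subclosed_compact _ cptM) => //.
  apply: (@preimage_closed _ _ (fun x => f x ord0 ord0)
    [set z | y ord0 ord0 <= z]) => [x _|]; [exact: fc|exact: closed_ge].
pose m x := \sum_(i < k) (f x ord0 (lift ord0 i) - y ord0 (lift ord0 i)) ^+ 2.
have mcont : continuous m.
  move=> x; apply: cvg_big => [|i _]; first exact: add_continuous.
  by rewrite expr2; apply: cvgM; apply: cvgB => //; first [exact: fc|exact: cvg_cst].
have small d : 0 < d -> exists2 x, N x & m x <= d.
  move=> /(exists_almost_fiber Gcont Gmax Gge0)[t [At G0 Gd]].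
  exists (D t); first by move: G0; rewrite /G !mxE subr_ge0.
  by apply: le_trans Gd; apply: ler_sum => i _; rewrite /G !mxE.
have [x1 Nx1 _] := small 1 ltr01.
have [x /set_mem Nx xmin] :=
  compact_EVT_min (ex_intro _ _ Nx1) Ncpt (continuous_subspaceT mcont).
exists x => // i; apply/eqP; rewrite -subr_eq0 -sqrf_eq0.
have m_ge0 : 0 <= m x by apply: sumr_ge0 => j _; rewrite sqr_ge0.
have m0 : m x = 0.
  (* A positive minimum of [m] on [N] would be beaten by a point of [N] with at most half that
     value. *)
  apply/eqP; rewrite eq_le m_ge0 andbT leNgt; apply/negP => m_gt0.
  have [z /mem_set /xmin xz zm] := small _ (divr_gt0 m_gt0 (ltr0Sn R 1)).
  by lra.
move/eqP: m0; rewrite psumr_eq0 => [/allP /(_ i)|j _]; last exact: sqr_ge0.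
by rewrite mem_index_enum => /(_ isT).
Qed.

Lemma has_max_feasible (R : realType) (M : topologicalType) (k : nat)
    (f : M -> 'rV[R]_k.+1) (c : 'rV[R]_k) :
  compact [set: M] -> continuous f ->
  feasible_values f c !=set0 -> has_max (feasible_values f c).
Proof.
move=> cptM ctsf [_ [x0 x0c _]].
have fc j : continuous (fun x => f x ord0 j) by exact: continuous_coord.
have Ncpt : compact [set x | on_fiber c (f x)].
  apply: (subclosed_compact _ cptM) => //.
  rewrite (_ : [set x | _] = \bigcap_(i in [set: 'I_k])
      ((fun x => f x ord0 (lift ord0 i)) @^-1` [set c ord0 i])); last first.
    by apply/seteqP; split => x /= xc i; [move=> _|]; apply: xc.
  apply: closed_bigI => i _; apply: preimage_closed => [x _|]; first exact: fc.
  exact: closed_eq.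
have [x /set_mem xc xmax] :=
  compact_EVT_max (ex_intro _ _ x0c) Ncpt (continuous_subspaceT (fc ord0)).
exists (f x ord0 ord0); split; first by exists x.
by move=> _ [z zc <-]; exact/xmax/mem_set.
Qed.

Theorem corollary1p1 (R : realType) (M : topologicalType) (k : nat)
    (f : M -> 'rV[R]_k.+1) (cptM : compact [set: M]) (ctsf : continuous f)
    (dsf : Lagrangian_dual_sectioned f) (c : 'rV[R]_k) :
  [/\ feasible_values f c !=set0 -> has_max (feasible_values f c),
      fiber_values (conv_hull (range f)) c !=set0 ->
        has_max (fiber_values (conv_hull (range f)) c) &
      optimal_value f c = emax (fiber_values (conv_hull (range f)) c)].
Proof.
set A := feasible_values f c; set B := fiber_values _ c.
have AB : A `<=` B.
  move=> _ [x xc <-]; exists (f x) => //; split => //.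
  by apply: sub_gen_smallest; exists x.
have BA b : B b -> exists2 a, A a & b <= a.
  move=> [y [yf yc] <-].
  have [x xy yx] := conv_hull_dominated cptM ctsf dsf yf.
  by exists (f x ord0 ord0) => //; exists x => // i; rewrite xy yc.
(* As [A] lies in [B] and every element of [B] is dominated by one of [A], both have the same
   maxima; the values of [emax] then agree, including the default -oo. *)
have maxE : A `&` ubound A = B `&` ubound B.
  apply/seteqP; split => [a [Aa ubA]|b [Bb ubB]].
    by split; [exact: AB|move=> b /BA[a' Aa' ba']; exact: (le_trans ba' (ubA _ Aa'))].
  have [a Aa ba] := BA _ Bb.
  have -> : b = a by apply/eqP; rewrite eq_le ba ubB //; exact: AB.
  by split => // a' Aa'; exact: (le_trans (ubB _ (AB _ Aa')) ba).
have maxA : A !=set0 -> has_max A by exact: has_max_feasible.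
split => //; last by rewrite /optimal_value /emax maxE.
(* Attainment in the hull is inherited from [A], which is nonempty as soon as [B] is. *)
by move=> [b /BA[a Aa _]]; rewrite /has_max -maxE; apply: maxA; exists a.
Qed.
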